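(* Assume $\mathbb F$ is algebraically closed with $\operatorname{char}\mathbb F=0$. Let $a,b,c\in\mathbb F$ and $d\in\mathbb N$ be such that none of $a+b+c+1$, $-a+b+c$, $a-b+c$, $a+b-c$ lies in $\{\tfrac d2-i\mid i=1,\dots,d\}$. Then $A$ (resp. $B$, resp. $C$) is diagonalizable on $R_d(a,b,c)$ if and only if $a$ (resp. $b$, resp. $c$) does not belong to $\{\tfrac{i-d-1}{2}\mid i=1,2,\dots,2d-1\}$.
   Context: The Racah algebra $\Re$ is the unital associative $\mathbb F$-algebra with generators $A,B,C,D$ and relations $[A,B]=[B,C]=[C,A]=2D$ together with the requirement that each of $\alpha:=[A,D]+AC-BA$, $\beta:=[B,D]+BA-CB$, $\gamma:=[C,D]+CB-AC$ is central in $\Re$; $\delta:=A+B+C$. For $a,b,c\in\mathbb F$ and $d\in\mathbb N$ set $\theta_i=(a+\tfrac d2-i)(a+\tfrac d2-i+1)$, $\theta_i^*=(b+\tfrac d2-i)(b+\tfrac d2-i+1)$, $\varphi_i=i(i-d-1)(a+b+c+\tfrac d2-i+2)(a+b-c+\tfrac d2-i+1)$. $R_d(a,b,c)$ denotes the $(d+1)$-dimensional $\Re$-module with a basis $v_0,\dots,v_d$ such that $Av_i=\theta_iv_i+v_{i+1}$ ($v_{d+1}=0$), $Bv_i=\theta_i^*v_i+\varphi_iv_{i-1}$ ($v_{-1}=0$), and $\alpha,\beta,\delta$ act as the scalars $(c-b)(c+b+1)(a-\tfrac d2)(a+\tfrac d2+1)$, $(a-c)(a+c+1)(b-\tfrac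 d2)(b+\tfrac d2+1)$, $\tfrac d2(\tfrac d2+1)+a(a+1)+b(b+1)+c(c+1)$ respectively (exists, unique up to isomorphism). *)

(* Defs.v *)
From HB Require Import structures.
From mathcomp Require Import all_boot all_order all_algebra.
Set Implicit Arguments. Unset Strict Implicit. Unset Printing Implicit Defensive.
Import Order.TTheory GRing.Theory Num.Theory.
Local Open Scope ring_scope.

(* Parameters of the Racah-algebra module R_d(a,b,c), basis v_0..v_d.
   Matrices use the convention M i j = coefficient of v_i in X v_j
   (column j is the image of v_j). *)
Section Racah.
Variable F : fieldType.
Variables (a b c : F) (d : nat).

Definition halfd : F := d%:R / 2%:R.

Definition theta (i : nat) : F :=
  (a + halfd - i%:R) * (a + halfd - i%:R + 1).
Definition thetas (i : nat) : F :=
  (b + halfd - i%:R) * (b + halfd - i%:R + 1).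
Definition phi (i : nat) : F :=
  i%:R * (i%:R - d%:R - 1) * (a + b + c + halfd - i%:R + 2)
    * (a + b - c + halfd - i%:R + 1).

(* scalar by which delta = A + B + C acts *)
Definition delta_val : F :=
  halfd * (halfd + 1) + a * (a + 1) + b * (b + 1) + c * (c + 1).

Definition RA : 'M[F]_d.+1 :=
  \matrix_(i, j) (if i == j :> nat then theta j
                  else if i == j.+1 :> nat then 1 else 0).

Definition RB : 'M[F]_d.+1 :=
  \matrix_(i, j) (if i == j :> nat then thetas j
                  else if i.+1 == j :> nat then phi j else 0).

(* C acts as delta - A - B since delta = A + B + C acts as a scalar *)
Definition RC : 'M[F]_d.+1 := delta_val%:M - RA - RB.
End Racah.

Definition in_shift_set (F : fieldType) (d : nat) (x : F) : Prop :=
  exists i : nat, (1 <= i <= d)%N /\ x = halfd F d - i%:R.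

Definition in_bad_set (F : fieldType) (d : nat) (x : F) : Prop :=
  exists i : nat, (1 <= i <= (2 * d).-1)%N /\ x = (i%:R - d%:R - 1) / 2%:R.

(* Main.v *)
(** In the given basis A, C and the transpose of B are Hessenberg with nonzero
    subdiagonal (for B this means that no phi_i vanishes), so the first
    basis vector is cyclic: minimal and characteristic polynomials coincide, and
    such a matrix is diagonalizable iff its characteristic polynomial has simple
    roots.  The roots
    are (x + d/2 - i)(x + d/2 - i + 1), 0 <= i <= d, for x = a, b, c; this is
    immediate for the triangular A and B, while for the tridiagonal C the product
    of the C - (c + d/2 - i)(c + d/2 - i + 1) is shown to kill v_0 by an explicit
    formula for its partial products on v_0.  Finally, two of these roots, with
    indices i <> j, coincide iff x = (i + j - d - 1)/2. *)
Require Import Defs.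
From HB Require Import structures.
From mathcomp Require Import all_boot all_order all_algebra.
From mathcomp Require Import separable ring zify.
Import Order.TTheory GRing.Theory Num.Theory.
Local Open Scope ring_scope.

(** * Unreduced Hessenberg matrices, cyclic vectors and nonderogatory matrices *)

Section Nonderogatory.
Context {F : fieldType} {n : nat}.
Implicit Types (M : 'M[F]_n.+1) (p q : {poly F}).

Lemma trmx_horner_mx M p : horner_mx M^T p = (horner_mx M p)^T.
Proof.
elim/poly_ind: p => [|p e IHp]; first by rewrite !rmorph0 trmx0.
rewrite [in RHS]mulrC !rmorphD !rmorphM /= !horner_mx_X !horner_mx_C linearD /=.
by rewrite tr_scalar_mx trmx_mul IHp.
Qed.

Lemma char_poly_trmx M : char_poly M^T = char_poly M.
Proof.
rewrite /char_poly -[in RHS]det_tr; congr (\det _).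
by apply/matrixP=> i j; rewrite !mxE eq_sym.
Qed.

Definition unreduced_hessenberg M :=
  (forall i j : 'I_n.+1, (j.+1 < i)%N -> M i j = 0)
  /\ (forall i j : 'I_n.+1, i = j.+1 :> nat -> M i j != 0).

(** Each multiplication by [M] pushes the last nonzero coordinate down by exactly one row, scaling
    it by a subdiagonal entry. Hence the last nonzero coordinate of [v] sits at index deg p, which
    is [(size p).-1]. *)
Lemma horner_mx_delta_hessenberg M p : unreduced_hessenberg M ->
  (size p <= n.+1)%N ->
  let v : 'cV_n.+1 := horner_mx M p *m delta_mx 0 0 in
  (forall i : 'I_n.+1, (size p <= i)%N -> v i 0 = 0)
  /\ (forall i : 'I_n.+1, size p = i.+1 -> v i 0 != 0).
Proof.
case=> M0 M1.
elim/poly_ind: p => [_|p e IHp].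
  rewrite size_poly0 rmorph0 mul0mx; split=> // i _; exact: mxE.
have [-> | p0] := eqVneq p 0.
  rewrite mul0r add0r horner_mx_C mul_scalar_mx => _.
  rewrite size_polyC; have [->|e0] := eqVneq e 0.
    by rewrite scale0r; split=> // i _; rewrite mxE.
  split=> i /= Hi; rewrite !mxE eqxx andbT.
    by case: eqP Hi => [-> // | _]; rewrite mulr0.
  have -> : i = 0 by apply: val_inj; case: Hi.
  by rewrite eqxx mulr1.
rewrite size_MXaddC (negPf p0) /= => sp; have [IH0 IH1] := IHp (ltnW sp).
have E i : (horner_mx M (p * 'X + e%:P) *m delta_mx 0 0 : 'cV_n.+1) i 0
  = \sum_k M i k * (horner_mx M p *m delta_mx 0 0 : 'cV_n.+1) k 0
    + e * (i == 0)%:R.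
  rewrite mulrC rmorphD rmorphM /= horner_mx_X horner_mx_C mulmxDl.
  by rewrite -mulmxA mul_scalar_mx mxE mxE !mxE andbT.
split=> i Hi; rewrite E.
  have -> : (i == 0) = false by apply/eqP=> i0; rewrite i0 in Hi.
  rewrite mulr0 addr0 big1 // => k _.
  have [kp | kp] := leqP (size p) k; first by rewrite IH0 // mulr0.
  by rewrite M0 ?mul0r //; apply: leq_ltn_trans Hi.
case: Hi => Hi.
have sp0 : (0 < size p)%N by rewrite size_poly_gt0.
have -> : (i == 0) = false by apply/eqP=> i0; rewrite Hi i0 in sp0.
have kP : ((size p).-1 < n.+1)%N by rewrite prednK // ltnW.
rewrite mulr0 addr0 (bigD1 (Ordinal kP)) //= big1 ?addr0.
  by rewrite mulf_neq0 ?M1 ?IH1 //= prednK.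
move=> k kne.
have [kp | kp] := leqP (size p) k; first by rewrite IH0 // mulr0.
rewrite M0 ?mul0r // -Hi ltn_neqAle kp andbT.
by apply: contra kne => /eqP ks; apply/eqP/val_inj; rewrite /= -ks.
Qed.

Lemma hessenberg_cyclic M p : unreduced_hessenberg M -> (size p <= n.+1)%N ->
  horner_mx M p *m delta_mx 0 0 = 0 :> 'cV_n.+1 -> p = 0.
Proof.
move=> HM sp Hp; apply/eqP/contraT; rewrite -size_poly_gt0 => sp0.
have kP : ((size p).-1 < n.+1)%N by rewrite prednK.
have [_ /(_ (Ordinal kP))] := horner_mx_delta_hessenberg M p HM sp.
by rewrite /= prednK // Hp mxE eqxx => /(_ erefl).
Qed.

(** Since [size] is degree plus one, this says that the minimal polynomial has full degree
    [n.+1]. *)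
Definition nonderogatory M :=
  forall p, (size p <= n.+1)%N -> horner_mx M p = 0 -> p = 0.

Lemma hessenberg_nonderogatory M : unreduced_hessenberg M -> nonderogatory M.
Proof.
by move=> HM p sp p0; apply: (hessenberg_cyclic M p HM sp); rewrite p0 mul0mx.
Qed.

Lemma nonderogatory_trmx M : nonderogatory M^T -> nonderogatory M.
Proof. by move=> HM p sp p0; apply: HM => //; rewrite trmx_horner_mx p0 trmx0. Qed.

(** Both polynomials are monic of degree [n.+1], so their difference has degree at most [n]; by
    Cayley-Hamilton it kills the cyclic vector, hence it is zero. *)
Lemma hessenberg_char_poly M q : unreduced_hessenberg M -> q \is monic ->
  size q = n.+2 -> horner_mx M q *m delta_mx 0 0 = 0 :> 'cV_n.+1 ->
  char_poly M = q.
Proof.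
move=> HM qm sq q0; apply/eqP; rewrite -subr_eq0; apply/eqP.
apply: (hessenberg_cyclic M) => //; last first.
  by rewrite rmorphB /= Cayley_Hamilton sub0r mulNmx q0 oppr0.
apply/leq_sizeP => j; rewrite leq_eqVlt coefB => /predU1P[<-|jn].
  have := char_poly_monic M; move: qm; rewrite !monicE !lead_coefE.
  by rewrite sq size_char_poly /= => /eqP-> /eqP->; rewrite subrr.
by rewrite !nth_default ?subrr ?sq ?size_char_poly.
Qed.

(** The minimal polynomial divides the characteristic one and has the same degree, so the
    simple-root criterion for the former transfers to the latter. *)
Lemma diagonalizable_nonderogatory M (s : seq F) : nonderogatory M ->
  char_poly M = \prod_(x <- s) ('X - x%:P) -> diagonalizable M <-> uniq s.
Proof.
move=> HM Ms; rewrite diagonalizableP; split=> [[rs urs Mrs]|us]; last first.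
  by exists s => //; rewrite -Ms mxminpoly_dvd_char.
rewrite -separable_prod_XsubC -Ms.
apply: (@dvdp_separable _ (\prod_(x <- rs) ('X - x%:P))); last first.
  by rewrite separable_prod_XsubC.
apply: dvdp_trans Mrs; have := mxminpoly_dvd_char M.
suff sM : size (char_poly M) = size (mxminpoly M).
  by move/dvdp_size_eqp; rewrite -sM eqxx => /esym/eqp_dvdl <-.
apply/eqP; rewrite eqn_leq (dvdp_leq _ (mxminpoly_dvd_char M)) ?andbT;
  last by rewrite monic_neq0 // char_poly_monic.
rewrite size_char_poly ltnNge; apply/negP=> sp.
have := HM _ sp (mx_root_minpoly M).
by move/eqP; rewrite (negPf (monic_neq0 (mxminpoly_monic M))).
Qed.

End Nonderogatory.

(** * Characteristic polynomials of the three Racah generators *)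

Section RacahSpectra.
Context {F : fieldType} (nz2 : 2%:R != 0 :> F) (a b c : F) (d : nat).

Lemma natr_halfd : d%:R = halfd F d + halfd F d.
Proof. by rewrite /halfd; field. Qed.

(** The map t -> t(t + 1) is symmetric under t -> -1 - t. Two values thus agree when the arguments a
    + d/2 - i and a + d/2 - j are equal or add up to -1. *)
Lemma eq_theta i j :
  (theta a d i == theta a d j) =
  ((i%:R == j%:R :> F) || (a == ((i + j)%:R - d%:R - 1) / 2%:R)).
Proof.
rewrite -subr_eq0.
have -> : theta a d i - theta a d j =
    (j%:R - i%:R) * (2%:R * (a - ((i + j)%:R - d%:R - 1) / 2%:R)).
  by rewrite /theta natrD natr_halfd; field.
by rewrite !mulf_eq0 (negPf nz2) /= !subr_eq0 [j%:R == _]eq_sym.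
Qed.

Lemma mul_RA (f : nat -> F) (i : 'I_d.+1) :
  (RA a d *m \col_j f j) i 0 =
  theta a d i * f i + (if nat_of_ord i is m.+1 then f m else 0).
Proof.
rewrite mxE (bigD1 i) //= !mxE eqxx; congr (_ + _).
case Ei: (nat_of_ord i) => [|m].
  rewrite big1 // => j ji; rewrite !mxE Ei eq_sym /=.
  by rewrite -[0%N]Ei (inj_eq val_inj) (negPf ji) mul0r.
have lt_m : (m < d.+1)%N by rewrite ltnW // -Ei.
rewrite (bigD1 (Ordinal lt_m)) /=; last by rewrite -(inj_eq val_inj) /= Ei ltn_eqF.
rewrite !mxE /= Ei (gtn_eqF (ltnSn m)) eqxx mul1r big1 ?addr0 // => j /andP[ji jm].
rewrite !mxE eq_sym (inj_eq val_inj) (negPf ji) Ei eqSS eq_sym.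
by rewrite -(inj_eq val_inj) /= in jm; rewrite (negPf jm) mul0r.
Qed.

Lemma mul_RB (f : nat -> F) (i : 'I_d.+1) :
  (RB a b c d *m \col_j f j) i 0 =
  thetas b d i * f i + phi a b c d i.+1 * f i.+1.
Proof.
rewrite mxE (bigD1 i) //= !mxE eqxx; congr (_ + _).
have [id | id] := ltnP i.+1 d.+1.
  rewrite (bigD1 (Ordinal id)) /=; last by rewrite -(inj_eq val_inj) /= gtn_eqF.
  rewrite !mxE /= (ltn_eqF (ltnSn i)) eqxx big1 ?addr0 // => j /andP[ji jm].
  rewrite !mxE eq_sym (inj_eq val_inj) (negPf ji) eq_sym.
  by rewrite -(inj_eq val_inj) /= in jm; rewrite (negPf jm) mul0r.
have -> : nat_of_ord i = d by apply/eqP; rewrite eqn_leq -ltnS ltn_ord.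
(* In the last row the out-of-range value [f d.+1] drops out, because [phi] at [d.+1] has the zero
   factor i - d - 1. *)
rewrite big1 => [|j ji].
  by rewrite /phi -natr1; ring.
rewrite !mxE eq_sym (inj_eq val_inj) (negPf ji) gtn_eqF ?mul0r //.
exact: leq_trans (ltn_ord j) id.
Qed.

(* [krylov_coef k n] is, up to the sign [(-1)^k], the coefficient of [v_n] in
   [(C - theta_0) ... (C - theta_(k-1)) v_0], where the [theta_i] are taken at
   [c].  The closed form comes from dual Hahn polynomials, whose three-term
   recurrence is that of [C]; the vanishing of [krylov_factor d] is what makes
   the vector zero for [k = d + 1]. *)
Definition krylov_factor (j : nat) : F :=
  (d%:R - j%:R) * (a + b + c + halfd F d - j%:R + 1).

Definition krylov_coef (k n : nat) : F :=
  'C(k, n)%:R * \prod_(n <= j < k) krylov_factor j.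

Lemma natr_mul_bin_left k n :
  n.+1%:R * 'C(k, n.+1)%:R = (k%:R - n%:R) * 'C(k, n)%:R :> F.
Proof.
have [nk | kn] := leqP n k; first by rewrite -natrM mul_bin_left natrM natrB.
by rewrite !bin_small ?mulr0 // ltnW.
Qed.

(** Up to sign, [phi] at [n.+1] contains [krylov_factor n], the one factor missing from the product
    in [krylov_coef k n.+1]; its factor [n.+1] lowers the binomial coefficient. *)
Lemma phi_krylov_coef k n :
  phi a b c d n.+1 * krylov_coef k n.+1 =
  - (k%:R - n%:R) * (a + b - c + halfd F d - n%:R) * krylov_coef k n.
Proof.
have [nk | kn] := ltnP n k; last first.
  rewrite /krylov_coef [in LHS]bin_small // mul0r mulr0.
  move: kn; rewrite leq_eqVlt => /predU1P[->|kn].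
    by rewrite subrr oppr0 !mul0r.
  by rewrite bin_small // mul0r mulr0.
rewrite /krylov_coef [in RHS]big_ltn //.
set P := \prod_(_ <= j < _) _.
transitivity (n.+1%:R * 'C(k, n.+1)%:R * (n.+1%:R - d%:R - 1)
  * (a + b + c + halfd F d - n.+1%:R + 2)
  * (a + b - c + halfd F d - n.+1%:R + 1) * P).
  by rewrite /phi; ring.
by rewrite natr_mul_bin_left /krylov_factor -natr1; ring.
Qed.

(** This is the coordinate form of applying -(C - theta_k), with C = delta - A - B; the minus sign
    is the one that alternates with [k]. *)
Lemma krylov_coef_recurrence k n :
  krylov_coef k.+1 n =
  (if n is m.+1 then krylov_coef k m else 0)
  - (delta_val a b c d - theta a d n - thetas b d n - theta c d k)
    * krylov_coef k n
  + phi a b c d n.+1 * krylov_coef k n.+1.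
Proof.
rewrite phi_krylov_coef; case: n => [|n].
  rewrite /krylov_coef big_nat_recr //= !bin0 /krylov_factor.
  rewrite /delta_val /theta /thetas natr_halfd.
  set P := \prod_(_ <= j < _) _; ring.
have [nk | kn] := ltnP n k; last first.
  rewrite /krylov_coef binS natrD ['C(k, n.+1)]bin_small // !big_geq ?(leqW kn) //.
  by ring.
rewrite /krylov_coef big_nat_recr //= [in X in X - _]big_ltn //=.
set P := \prod_(_ <= j < _) _.
have binE := natr_mul_bin_left k n.
rewrite binS natrD.
(* The difference [krylov_factor k - krylov_factor n] is divisible by k - n, and [binE] then turns
   (k - n) ['C(k, n)] into a multiple of ['C(k, n.+1)]. *)
transitivity (P * ('C(k, n.+1)%:R * krylov_factor k
  + (k%:R - n%:R) * 'C(k, n)%:R * (k%:R + n%:R - d%:R - (a + b + c + halfd F d + 1))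
  + 'C(k, n)%:R * krylov_factor n)).
  by rewrite /krylov_factor; ring.
rewrite -binE /krylov_factor /delta_val /theta /thetas -natr1 natr_halfd.
ring.
Qed.

Lemma horner_RC_krylov k :
  horner_mx (RC a b c d)
    (\prod_(x <- [seq theta c d i | i <- iota 0 k]) ('X - x%:P)) *m delta_mx 0 0 =
  \col_(n < d.+1) ((-1) ^+ k * krylov_coef k n).
Proof.
elim: k => [|k IHk].
  rewrite big_nil rmorph1 mul1mx; apply/matrixP=> i j; rewrite !ord1 !mxE.
  rewrite andbT mul1r /krylov_coef big_geq // mulr1 -(inj_eq val_inj) /=.
  by case: (nat_of_ord i).
rewrite -(addn1 k) iotaD map_cat big_cat big_seq1 /= mulrC rmorphM /= -mulmxA IHk.
rewrite rmorphB /= horner_mx_X horner_mx_C addn1 add0n.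
apply/colP=> i; rewrite /RC !mulmxBl !mul_scalar_mx.
rewrite 3![(_ - _ : 'M_(_,_)) _ _]mxE.
rewrite [(- (RA _ _ *m _)) _ _]mxE [(- (RB _ _ _ _ *m _)) _ _]mxE.
rewrite (mul_RA (fun n => (-1) ^+ k * krylov_coef k n)).
rewrite (mul_RB (fun n => (-1) ^+ k * krylov_coef k n)) !mxE.
rewrite krylov_coef_recurrence exprS; case: (nat_of_ord i) => [|m]; ring.
Qed.

Lemma RA_hessenberg : unreduced_hessenberg (RA a d).
Proof.
split=> i j ij; rewrite mxE.
  by rewrite !gtn_eqF // ltnW.
by rewrite ij gtn_eqF // eqxx oner_neq0.
Qed.

Lemma trmx_RB_hessenberg :
  (forall i, (0 < i)%N -> (i <= d)%N -> phi a b c d i != 0) ->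
  unreduced_hessenberg (RB a b c d)^T.
Proof.
move=> phiN0; split=> i j ij; rewrite !mxE.
  by rewrite !ltn_eqF // ltnW.
by rewrite -ij ij ltn_eqF // eqxx -ij phiN0 -1?ltnS // ij.
Qed.

Lemma RC_hessenberg : unreduced_hessenberg (RC a b c d).
Proof.
split=> i j ij; rewrite !mxE -(inj_eq val_inj) /=.
  have ji := ltnW ij.
  by rewrite !gtn_eqF ?mulr0n ?subr0 // leqW // ltnW.
rewrite ij eqxx (gtn_eqF (ltnSn j)) (gtn_eqF (leqW (ltnSn j))) mulr0n.
by rewrite subr0 sub0r oppr_eq0 oner_neq0.
Qed.

Lemma char_poly_RC : char_poly (RC a b c d) =
  \prod_(x <- [seq theta c d i | i <- iota 0 d.+1]) ('X - x%:P).
Proof.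
apply: hessenberg_char_poly RC_hessenberg (monic_prod_XsubC _ _ _) _ _.
  by rewrite size_prod_XsubC size_map size_iota.
rewrite horner_RC_krylov; apply/colP=> i; rewrite !mxE /krylov_coef.
by rewrite big_nat_recr -1?ltnS //= {2}/krylov_factor subrr mul0r !mulr0.
Qed.

Lemma prod_XsubC_theta (x : F) :
  \prod_(y <- [seq theta x d i | i <- iota 0 d.+1]) ('X - y%:P) =
  \prod_(i < d.+1) ('X - (theta x d i)%:P).
Proof.
rewrite big_map -(big_mkord xpredT (fun i => 'X - (theta x d i)%:P)).
by rewrite /index_iota subn0.
Qed.

Lemma char_poly_RA : char_poly (RA a d) =
  \prod_(x <- [seq theta a d i | i <- iota 0 d.+1]) ('X - x%:P).
Proof.
rewrite char_poly_trig; last first.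
  apply/is_trig_mxP=> i j ij; rewrite mxE ltn_eqF // ltn_eqF //.
  exact: leq_trans ij (leqnSn _).
rewrite prod_XsubC_theta.
by apply: eq_bigr => i _; rewrite mxE eqxx.
Qed.

Lemma char_poly_RB : char_poly (RB a b c d) =
  \prod_(x <- [seq theta b d i | i <- iota 0 d.+1]) ('X - x%:P).
Proof.
rewrite -char_poly_trmx char_poly_trig; last first.
  apply/is_trig_mxP=> i j ij; rewrite !mxE gtn_eqF // gtn_eqF //.
  exact: leq_trans ij (leqnSn _).
rewrite prod_XsubC_theta.
by apply: eq_bigr => i _; rewrite !mxE eqxx.
Qed.

End RacahSpectra.

(** * Coincidences among the eigenvalues in characteristic zero *)

Section DistinctEigenvalues.
Context {F : fieldType} (charF0 : [pchar F] =i pred0).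

Lemma uniq_theta (x : F) d :
  uniq [seq theta x d i | i <- iota 0 d.+1] <-> ~ in_bad_set d x.
Proof.
have nat0 := (pcharf0P F).1 charF0.
have nz2 : 2%:R != 0 :> F by rewrite nat0.
have eqN (i j : nat) : (i%:R == j%:R :> F) = (i == j).
  wlog ij : i j / (i <= j)%N => [H|].
    by case/orP: (leq_total i j) => /H // E; rewrite eq_sym E eq_sym.
  by rewrite eq_sym -subr_eq0 -natrB // nat0 subn_eq0 eqn_leq ij.
split=> [U [k [/andP[k0 kd] xk]]|nbad].
  (* Truncated subtraction yields two distinct indices in 0..d with sum [k]: the pair (0, k) if k <=
     d, and (k - d, d) otherwise. *)
  pose j := (k - d)%N.
  have [jd kjd jk]: [/\ (j <= d)%N, (k - j <= d)%N & (j < k - j)%N].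
    by rewrite /j; split; lia.
  have /eqP : theta x d j = theta x d (k - j).
    apply/eqP; rewrite (eq_theta nz2) subnKC; last by lia.
    by rewrite -xk eqxx orbT.
  have N m : (m <= d)%N ->
      theta x d m = nth 0 [seq theta x d i | i <- iota 0 d.+1] m.
    by move=> md; rewrite (nth_map 0%N) ?size_iota // nth_iota.
  by rewrite !N // nth_uniq ?size_map ?size_iota // ltn_eqF.
rewrite map_inj_in_uniq ?iota_uniq // => i j.
rewrite !mem_iota /= !add0n => di dj /eqP; rewrite (eq_theta nz2) eqN.
case: eqVneq => //= ij /eqP xE; case: nbad; exists (i + j)%N; split=> //.
by move/eqP: ij => ij; lia.
Qed.

End DistinctEigenvalues.

Theorem theorem6p6 (F : closedFieldType) (charF0 : [pchar F] =i pred0)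
  (a b c : F) (d : nat)
  (h1 : ~ in_shift_set d (a + b + c + 1))
  (h2 : ~ in_shift_set d (- a + b + c))
  (h3 : ~ in_shift_set d (a - b + c))
  (h4 : ~ in_shift_set d (a + b - c)) :
  [/\ diagonalizable (RA a d) <-> ~ in_bad_set d a,
      diagonalizable (RB a b c d) <-> ~ in_bad_set d b
    & diagonalizable (RC a b c d) <-> ~ in_bad_set d c].
Proof.
have nat0 := (pcharf0P F).1 charF0.
have nz2 : 2%:R != 0 :> F by rewrite nat0.
split; rewrite -(uniq_theta charF0); apply: diagonalizable_nonderogatory.
- exact/hessenberg_nonderogatory/RA_hessenberg.
- exact: char_poly_RA.
- apply/nonderogatory_trmx/hessenberg_nonderogatory/trmx_RB_hessenberg.
  move=> i i0 id; have di := natr_halfd nz2 d.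
  (* Reversing the index gives the witness: y + d/2 - i + 1 = 0 means y = d/2 - (d + 1 - i). The
     last two factors of [phi] have this shape, with y = a + b + c + 1 and y = a + b - c. *)
  have shift (y : F) : ~ in_shift_set d y -> y + halfd F d - i%:R + 1 != 0.
    move=> ny; apply/eqP=> y0; apply: ny; exists (d.+1 - i)%N; split; first by lia.
    apply/eqP; rewrite -subr_eq0 natrB ?(leqW id) // -natr1 di -[0]y0; apply/eqP; ring.
  rewrite /phi !mulf_neq0 //.
  + by rewrite nat0 -lt0n.
  + have -> : i%:R - d%:R - 1 = - (d.+1 - i)%:R :> F.
      by rewrite natrB ?(leqW id) // -natr1; ring.
    by rewrite oppr_eq0 nat0 subn_eq0 -ltnNge.
  + have -> : a + b + c + halfd F d - i%:R + 2
        = a + b + c + 1 + halfd F d - i%:R + 1 by ring.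
    exact: shift.
  + exact: shift.
- exact: char_poly_RB.
- exact/hessenberg_nonderogatory/RC_hessenberg.
- exact: char_poly_RC.
Qed.
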